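(* Let $V$ be a finite-dimensional diffeological vector space of dimension $n$, with underlying vector space identified with $\mathbb{R}^n$, and let $\langle\cdot|\cdot\rangle_A$, $\langle v|w\rangle_A=v^tAw$ with $A$ a real symmetric $n\times n$ matrix, be a pseudo-metric on $V$. Let $V_0\leq V$ be the subspace spanned by all the eigenvectors of $A$ belonging to positive eigenvalues. Then the subspace $V_0$ splits off as a smooth direct summand of $V$.
   Context: A diffeology on a set $X$ is a collection of maps $U\to X$ (plots), $U$ ranging over open subsets of $\mathbb{R}^m$, $m\in\mathbb{N}$, such that: all constant maps are plots; if $p:U\to X$ is a plot and $h:U'\to U$ is an ordinary smooth map from an open set $U'$ of a Euclidean space, then $p\circ h$ is a plot; a map $U\to X$ that restricts to a plot on each member of an open cover of $U$ is a plot. A map between diffeological spaces is smooth if its composition with each plot of the source is a plot of the target. The product $X_1\times X_2$ has the product diffeology: a map $U\to X_1\times X_2$ is a plot iff both of its components are plots. The standard diffeology on $\mathbb{R}^k$ consists of all ordinary smooth maps into $\mathbb{R}^k$. A diffeological vector space is a real vector space $V$ with a diffeology for which addition $V\times V\to V$ and scalar multiplication $\mathbb{R}\times V\to V$ are smooth ($\mathbb{R}$ standard). The diffeological dual $V^*$ is the vector space of all smooth linear functionals $V\to\mathbb{R}$ ($\mathbb{R}$ standard). A pseudo-metric on an $n$-dimensional diffeological vector space $V$ is a symmetric bilinear form $V\times V\to\mathbb{R}$, smooth for the product diffeology on $V\times V$ and the standard diffeology on $\mathbb{R}$, such that the eigenvalue $0$ (of its matrix) has multiplicity $n-\dim(V^*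 )$ and all the other eigenvalues are positive. The subset diffeology on a subspace $W\leq V$ consists of the maps $U\to W$ whose composition with the inclusion $W\hookrightarrow V$ is a plot of $V$. A vector space decomposition $V=W_0\oplus W_1$ is called smooth if the given diffeology of $V$ coincides with the vector space sum diffeology obtained from the subset diffeologies of $W_0$ and $W_1$, i.e. the diffeology whose plots are the maps that are locally sums $p_0+p_1$ with $p_i$ a plot of $W_i$. A subspace $W_0\leq V$ splits off as a smooth direct summand if there is a subspace $W_1\leq V$ such that $V=W_0\oplus W_1$ is a smooth decomposition. *)

(* Defs.v *)
From HB Require Import structures.
From mathcomp Require Import all_boot all_order all_algebra.
From mathcomp Require Import all_classical all_reals all_analysis.

Set Implicit Arguments.
Unset Strict Implicit.
Unset Printing Implicit Defensive.
Import Order.TTheory GRing.Theory Num.Theory.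
Import numFieldNormedType.Exports.

Local Open Scope classical_set_scope.
Local Open Scope ring_scope.

(* A map U -> X defined on a subset U of R^m is encoded as a total function
   'rV_m -> X, of which only the values on U are relevant; this requires X to
   be inhabited, which holds for vector spaces. *)

(* All iterated partial derivatives of order at most k exist and are
   continuous on U, which is meant to be open. *)
Fixpoint Ck (R : realType) (m : nat) (W : normedModType R) (k : nat)
    (U : set 'rV[R]_m) (f : 'rV[R]_m -> W) : Prop :=
  (forall x, U x -> {for x, continuous f}) /\
  if k is k'.+1 then
    forall i : 'I_m,
      (forall x, U x -> derivable f x (delta_mx 0 i)) /\
      Ck k' U (fun x => 'D_(delta_mx 0 i) f x)
  else True.

Definition Cinfty (R : realType) (m : nat) (W : normedModType R)
    (U : set 'rV[R]_m) (f : 'rV[R]_m -> W) : Prop :=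
  forall k, Ck k U f.

Section Diffeology.
Variable R : realType.

Definition plots (X : Type) : Type :=
  forall m : nat, set 'rV[R]_m -> ('rV[R]_m -> X) -> Prop.

Record is_diffeology (X : Type) (D : plots X) : Prop := {
  plot_open : forall m (U : set 'rV[R]_m) p, D m U p -> open U;
  (* plots are maps on U: values outside U do not matter *)
  plot_ext : forall m (U : set 'rV[R]_m) p q,
    (forall x, U x -> p x = q x) -> D m U p -> D m U q;
  plot_cst : forall m (U : set 'rV[R]_m) (x : X),
    open U -> D m U (fun=> x);
  plot_comp : forall m m' (U : set 'rV[R]_m) (U' : set 'rV[R]_m') p h,
    D m U p -> open U' -> Cinfty U' h -> h @` U' `<=` U -> D m' U' (p \o h);
  plot_local : forall m (U : set 'rV[R]_m) (C : set (set 'rV[R]_m)) p,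
    \bigcup_(O in C) O = U -> (forall O, C O -> open O /\ D m O p) ->
    D m U p }.

Definition smooth (X Y : Type) (DX : plots X) (DY : plots Y) (f : X -> Y) :=
  forall m (U : set 'rV[R]_m) p, DX m U p -> DY m U (f \o p).

Definition std_plots (W : normedModType R) : plots W :=
  fun m U p => open U /\ Cinfty U p.

Arguments std_plots W m U p : clear implicits.

Definition prod_plots (X Y : Type) (DX : plots X) (DY : plots Y) :
    plots (X * Y) :=
  fun m U p => DX m U (fst \o p) /\ DY m U (snd \o p).

Record is_dvs (V : lmodType R) (D : plots V) : Prop := {
  dvs_diffeology : is_diffeology D;
  dvs_add : smooth (prod_plots D D) D (fun u => u.1 + u.2);
  dvs_scale : smooth (prod_plots (std_plots R^o) D) D (fun u => u.1 *: u.2) }.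

Definition subspace_plots (V : vectType R) (D : plots V) (W : {vspace V}) :
    plots (subvs_of W) :=
  fun m U p => D m U (vsval \o p).

Definition sum_plots (V : vectType R) (W0 W1 : {vspace V})
    (D0 : plots (subvs_of W0)) (D1 : plots (subvs_of W1)) : plots V :=
  fun m U p => open U /\
    forall x, U x -> exists O : set 'rV[R]_m, exists p0 p1,
      [/\ open O, O x, O `<=` U, D0 m O p0 /\ D1 m O p1 &
          forall y, O y -> p y = vsval (p0 y) + vsval (p1 y)].

Definition smooth_decomposition (V : vectType R) (D : plots V)
    (W0 W1 : {vspace V}) : Prop :=
  [/\ (W0 + W1)%VS = fullv, directv (W0 + W1) &
      forall m U p, D m U p <->
        sum_plots (subspace_plots D (W := W0))
                  (subspace_plots D (W := W1)) U p].

Definition splits_off (V : vectType R) (D : plots V) (W0 : {vspace V}) : Prop :=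
  exists W1 : {vspace V}, smooth_decomposition D W0 W1.

(* Linear span of a possibly infinite set of vectors; the choice made by xget
   is justified by vspan_setP. *)
Definition vspan_set (V : vectType R) (S : set V) : {vspace V} :=
  xget 0%VS [set W : {vspace V} | forall v,
    v \in W <-> exists2 s : seq V, (forall u, u \in s -> S u) & v \in span s].

Lemma vspan_setP (V : vectType R) (S : set V) v :
  v \in vspan_set S <->
  exists2 s : seq V, (forall u, u \in s -> S u) & v \in span s.
Proof.
suff ex : exists W : {vspace V}, forall v, v \in W <->
    exists2 s : seq V, (forall u, u \in s -> S u) & v \in span s.
  exact: (xgetPex 0%VS ex).
pose P d := `[< exists2 s : seq V, (forall u, u \in s -> S u) &
                \dim (span s) = d >].
have exP : exists d, P d by exists (\dim (span ([::] : seq V))); apply/asboolP; exists [::].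
have ubP d : P d -> (d <= \dim (fullv : {vspace V}))%N.
  by move=> /asboolP[s _ <-]; rewrite dimvS// subvf.
case: (ex_maxnP exP ubP) => d /asboolP[s sS sd] dmax.
have Ss u : S u -> u \in span s.
  move=> Su; suff /eqP -> : span s == span (u :: s).
    by rewrite memv_span// mem_head.
  rewrite eqEdim span_cons addvSr sd -span_cons dmax//; apply/asboolP.
  by exists (u :: s) => // w; rewrite in_cons => /predU1P[->|/sS].
exists (span s) => w; split=> [ws|[s' s'S]]; first by exists s.
by apply/subvP/span_subvP => u /s'S; exact: Ss.
Qed.

(* The diffeological dual; memv_dual shows that its elements are exactly the
   smooth linear functionals. *)
Definition ddual (V : vectType R) (D : plots V) : {vspace 'Hom(V, R^o)} :=
  vspan_set [set f : 'Hom(V, R^o) | smooth D (std_plots R^o) f].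

Lemma Ck_linear (m : nat) (W : normedModType R) (U : set 'rV[R]_m) k
    (f g h : 'rV[R]_m -> W) (a : R) :
  open U -> Ck k U f -> Ck k U g -> (forall x, U x -> h x = a *: f x + g x) ->
  Ck k U h.
Proof.
move=> oU; elim: k f g h => [|k IH] f g h [cf df] [cg dg] hE.
all: have near_h x : U x -> \near x, ((a \*: f) + g) x = h x by
  move=> Ux; apply: filterS (open_nbhs_nbhs (conj oU Ux)) => y /hE ->.
all: have ch x (Ux : U x) : {for x, continuous h}.
1,3: have hx := nbhs_singleton (near_h x Ux); change (h @ x --> h x); rewrite -hx.
1,2: apply: cvg_trans (continuousD (continuousZl_tmp (k := a) (cf x Ux)) (cg x Ux)).
1,2: exact: (near_eq_cvg (near_h x Ux)).
  by split.
split=> // i; have [dfi Cf] := df i; have [dgi Cg] := dg i; split=> [x Ux|].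
  apply: near_eq_derivable (near_h x Ux) _; apply: derivableD; last exact: dgi.
  by apply: derivableZ; exact: dfi.
apply: IH Cf Cg _ => x Ux; rewrite -(near_eq_derive _ (near_h x Ux)).
have dfx := dfi x Ux; have dgx := dgi x Ux.
rewrite deriveD ?deriveZ//; exact: derivableZ.
Qed.

Lemma Ck_cst (m : nat) (W : normedModType R) (U : set 'rV[R]_m) k (c : W) :
  Ck k U (fun=> c).
Proof.
elim: k c => [|k IH] c; first by split=> [x _|//]; exact: cst_continuous.
split=> [x _|i]; first exact: cst_continuous.
split=> [x _|]; first exact: derivable_cst.
suff -> : 'D_(delta_mx 0 i) (fun=> c) = (fun=> 0 : W) :> ('rV[R]_m -> W) by exact: IH.
by apply/funext => x; exact: derive_cst.
Qed.

Lemma memv_dual (V : vectType R) (D : plots V) (f : 'Hom(V, R^o)) :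
  is_diffeology D -> f \in ddual D <-> smooth D (std_plots R^o) f.
Proof.
move=> Dd; split=> [/vspan_setP[s sS]|fs]; last first.
  by apply/vspan_setP; exists [:: f]; rewrite ?memv_span1// => u /[1!inE]/eqP->.
elim: s sS f => [|g s IH] sS f.
  rewrite span_nil memv0 => /eqP -> m U p Dp; split; first exact: plot_open Dp.
  by move=> k; rewrite (_ : _ \o p = fun=> 0);
    [exact: Ck_cst|apply/funext => x /=; rewrite lfunE].
rewrite span_cons => /memv_addP[_ /vlineP[a ->]] [w ws ->] m U p Dp.
have oU := plot_open Dd Dp; split=> // k.
have [_ Cg] := sS g (mem_head _ _) _ _ _ Dp.
have sS' u : u \in s -> smooth D (std_plots R^o) u.
  by move=> us; apply: sS; rewrite in_cons us orbT.
have [_ Cw] := IH sS' w ws _ _ _ Dp.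
apply: (Ck_linear (a := a) oU (Cg k) (Cw k)) => x _ /=.
by rewrite add_lfunE scale_lfunE.
Qed.

Definition mx_form (n : nat) (A : 'M[R]_n) (u : 'cV[R]_n * 'cV[R]_n) : R :=
  (u.1^T *m A *m u.2) 0 0.

(* [eigenvalue] refers to row eigenvectors, which amounts to the same for the
   symmetric matrix A; [mup] is the algebraic multiplicity. *)
Record pseudo_metric (n : nat) (D : plots 'cV[R]_n) (A : 'M[R]_n) : Prop := {
  pm_sym : A^T = A;
  pm_smooth : smooth (prod_plots D D) (std_plots R^o) (mx_form A);
  pm_mult0 : mup 0 (char_poly A) = (n - \dim (ddual D))%N;
  pm_pos : forall a, eigenvalue A a -> a != 0 -> 0 < a }.

Definition positive_eigenspace (n : nat) (A : 'M[R]_n) : {vspace 'cV[R]_n} :=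
  vspan_set [set v : 'cV[R]_n |
    v != 0 /\ exists2 a : R, 0 < a & A *m v = a *: v].

End Diffeology.

(* Main.v *)
(* Since all nonzero eigenvalues of A are positive, the spectral theorem
   identifies the subspace spanned by the positive eigenvectors with the image
   of A, and V = im A (+) ker A because A is symmetric.  The projection onto
   im A along ker A has the form B A.  The entries of A v are <e_i|v>_A, hence
   smooth functions of v, and scaling constant vectors and adding are smooth
   operations, so B A is smooth; a decomposition of V with a smooth projection
   is a smooth decomposition. *)
Require Import Defs.
From mathcomp Require Import all_boot all_order all_algebra.
From mathcomp Require Import all_classical all_reals all_analysis.
From mathcomp Require Import complex.

Set Implicit Arguments.
Unset Strict Implicit.
Unset Printing Implicit Defensive.
Import Order.TTheory GRing.Theory Num.Theory.
Import numFieldNormedType.Exports.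

Local Open Scope classical_set_scope.
Local Open Scope ring_scope.

(* A and its image over R[i] have the same minimal polynomial, which by the
   spectral theorem over R[i] is a product of distinct real linear factors. *)
Lemma symmetric_diagonalizable (R : rcfType) (n : nat) (A : 'M[R]_n) :
  A^T = A -> diagonalizable A.
Proof.
case: n A => [|n] A symA; first by rewrite flatmx0; exact: diagonalizable0.
pose toC := real_complex R; pose B := map_mx toC A.
have hermB : B \is hermsymmx.
  apply: realsym_hermsym.
    by apply/is_hermitianmxP; rewrite expr0 scale1r map_mx_id// map_trmx symA.
  apply/mxOverP => i j; rewrite mxE; apply/complex_realP; by eexists.
pose P := spectralmx B; pose d := spectral_diag B.
have Pu : P \in unitmx := spectral_unit B.
have BE : B = conjmx (invmx P) (diag_mx d).
  by rewrite conjVmx//; exact/orthomx_spectralP/hermitian_normalmx.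
(* A hermitian matrix has real eigenvalues, so each [d 0 i] is the image of its real part. *)
have dR i : toC (complex.Re (d 0 i)) = d 0 i.
  have /mxOverP /(_ 0 i) := hermitian_spectral_diag_real hermB.
  by move=> /complex_realP[r]; rewrite -/d => ->.
apply/diagonalizableP.
exists (undup [seq complex.Re (d 0 i) | i <- enum 'I_n.+1]).
  exact: undup_uniq.
rewrite -(dvdp_map toC) -mxminpoly_map -/B BE mxminpoly_uconj ?unitmx_inv//.
rewrite mxminpoly_diag rmorph_prod/=.
under [X in _ %| X]eq_bigr do rewrite rmorphB/= map_polyX map_polyC/=.
(* Removing repeated eigenvalues commutes with the injective [toC], so the factors can be compared
   over the complex numbers. *)
rewrite -(big_map toC predT (fun x => 'X - x%:P)) -undup_map_inj; last exact: fmorph_inj.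
suff -> : [seq toC i | i <- [seq complex.Re (d 0 i) | i <- enum 'I_n.+1]] =
    [seq d 0 i | i <- enum 'I_n.+1] by [].
by rewrite -map_comp; exact: eq_map.
Qed.

Lemma smooth_cst (R : realType) (X Y : Type) (DX : plots R X)
    (DY : plots R Y) (y : Y) :
  is_diffeology DX -> is_diffeology DY -> smooth DX DY (fun=> y).
Proof. by move=> dX dY m U p /(plot_open dX); exact: plot_cst. Qed.

Lemma smooth_add (R : realType) (V : lmodType R) (D : plots R V) (X : Type)
    (DX : plots R X) (f g : X -> V) :
  is_dvs D -> smooth DX D f -> smooth DX D g ->
  smooth DX D (fun x => f x + g x).
Proof.
by move=> dvsD fs gs m U p Dp;
  apply: (dvs_add dvsD (p := fun x => (f (p x), g (p x)))); split;
  [exact: fs|exact: gs].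
Qed.

Lemma smooth_scale (R : realType) (V : lmodType R) (D : plots R V) (X : Type)
    (DX : plots R X) (f : X -> R) (g : X -> V) :
  is_dvs D -> smooth DX (@std_plots R R^o) f -> smooth DX D g ->
  smooth DX D (fun x => f x *: g x).
Proof.
by move=> dvsD fs gs m U p Dp;
  apply: (dvs_scale dvsD (p := fun x => ((f (p x) : R^o), g (p x)))); split;
  [exact: fs|exact: gs].
Qed.

Lemma smooth_sum (R : realType) (V : lmodType R) (D : plots R V) (X : Type)
    (DX : plots R X) (I : Type) (r : seq I) (f : I -> X -> V) :
  is_dvs D -> is_diffeology DX -> (forall i, smooth DX D (f i)) ->
  smooth DX D (fun x => \sum_(i <- r) f i x).
Proof.
move=> dvsD dX fs; elim: r => [|i r IH].
  by under eq_fun do rewrite big_nil; apply: smooth_cst => //; exact: dvs_diffeology dvsD.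
by under eq_fun do rewrite big_cons; exact: smooth_add.
Qed.

Lemma smooth_opp (R : realType) (V : lmodType R) (D : plots R V) (X : Type)
    (DX : plots R X) (f : X -> V) :
  is_dvs D -> is_diffeology DX -> smooth DX D f ->
  smooth DX D (fun x => - f x).
Proof.
move=> dvsD dX fs; under eq_fun do rewrite -scaleN1r.
apply: smooth_scale dvsD _ fs => m U p /(plot_open dX) oU; split=> // k; exact: Ck_cst.
Qed.

(** A plot [p] is the sum of [f \o p] and [p - f \o p], both plots because [f] is smooth.
    Conversely, local sums are plots because addition is smooth and being a plot is a local
    property. *)
Lemma smooth_projection_decomposition (R : realType) (V : vectType R)
    (D : plots R V) (W0 W1 : {vspace V}) (f : V -> V) :
  is_dvs D -> directv (W0 + W1) -> smooth D D f ->
  (forall v, f v \in W0) -> (forall v, v - f v \in W1) ->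
  smooth_decomposition D W0 W1.
Proof.
move=> dvsD dir fs fW0 fW1; have dD := dvs_diffeology dvsD; split=> //.
  apply/eqP; rewrite eqEsubv subvf; apply/subvP => v _.
  by rewrite -(subrK (f v) v) addrC memv_add.
move=> m U p; split=> [Dp|[oU loc]].
  split=> [|x Ux]; first exact: plot_open Dp.
  have gs : smooth D D (fun v => v - f v).
    by apply: smooth_add => //; exact: smooth_opp.
  exists U, (vsproj W0 \o f \o p), (vsproj W1 \o (fun v => v - f v) \o p).
  split=> //; first exact: plot_open Dp.
    split; [apply: plot_ext (fs _ _ _ Dp)|apply: plot_ext (gs _ _ _ Dp)] => //.
      by move=> y _ /=; rewrite vsprojK.
    by move=> y _ /=; rewrite vsprojK.
  by move=> y _ /=; rewrite !vsprojK// addrC subrK.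
apply: (plot_local dD (C := [set O | [/\ open O, O `<=` U & D m O p]])).
  apply/seteqP; split=> [x [N [_ NU _] Nx]|x Ux]; first exact: NU.
  have [N [p0 [p1 [oN Nx NU [D0 D1] pE]]]] := loc x Ux.
  exists N => //; split=> //.
  apply: plot_ext (dvs_add dvsD (p := fun y => (vsval (p0 y), vsval (p1 y))) _) => //.
  by move=> y Ny; rewrite pE.
by move=> N [].
Qed.

Lemma smooth_mulmx_form (R : realType) (n : nat) (D : plots R 'cV[R]_n)
    (A B : 'M[R]_n) :
  is_dvs D -> smooth (prod_plots D D) (@std_plots R R^o) (mx_form A) ->
  smooth D D (fun v => B *m A *m v).
Proof.
move=> dvsD As; have dD := dvs_diffeology dvsD.
(* The scalar [mx_form A (delta_mx i 0, v)] is the [i]-th entry of [A v], here the coefficient of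
   the [i]-th column of [B]. *)
have -> : (fun v => B *m A *m v) =
    (fun v => \sum_i mx_form A (delta_mx i 0, v) *: col i B).
  apply/funext => v; apply/matrixP => i j; rewrite ord1 -mulmxA mxE summxE.
  apply: eq_bigr => k _; rewrite /mx_form/= trmx_delta -mulmxA -rowE.
  by rewrite [RHS]mxE mulrC [row _ _ _ _]mxE [col _ _ _ _]mxE.
apply: smooth_sum => // i; apply: smooth_scale => //; last exact: smooth_cst.
move=> m U p Dp; apply: (As _ _ (fun x => (delta_mx i 0, p x))).
by split=> //; apply: plot_cst (plot_open dD Dp).
Qed.

(** For [w = A u], symmetry gives [w^T w = u^T A A u = 0], and the diagonal entries of [w^T w] are
    sums of squares of entries of [w]. *)
Lemma symmetric_kernel_sqr (R : realFieldType) (m n : nat) (A : 'M[R]_n)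
    (u : 'M[R]_(n, m)) :
  A^T = A -> A *m (A *m u) = 0 -> A *m u = 0.
Proof.
move=> symA AAu; set w := A *m u; apply/matrixP => i j; rewrite [RHS]mxE.
have : (w^T *m w) j j = 0.
  by rewrite /w trmx_mul symA -mulmxA AAu mulmx0 mxE.
rewrite mxE => /eqP; rewrite psumr_eq0 => [/allP/(_ i)|k _].
  by rewrite mem_index_enum !mxE mulf_eq0 orbb => /(_ isT)/eqP.
by rewrite !mxE -expr2 sqr_ge0.
Qed.

(** The identities say that [B A] maps into the image of [A] and that [v - B A v] lies in its
    kernel. From [A = B A A], transposing gives [A = A A B^T], whence [B A = B A A B^T = A B^T]. *)
Lemma symmetric_projection (R : realFieldType) (n : nat) (A : 'M[R]_n) :
  A^T = A -> exists B C : 'M[R]_n, B *m A = A *m C /\ A *m (B *m A) = A.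
Proof.
move=> symA.
have /submxP[B AE] : (A <= A *m A)%MS.
  (* Row space inclusion is tested on the cokernel of [A A]: what [A A] kills, [A] already kills. *)
  rewrite submxE; apply/eqP/(symmetric_kernel_sqr symA).
  by rewrite mulmxA mulmx_coker.
exists B, B^T; have AE' : A = A *m A *m B^T.
  by rewrite -{1}symA {1}AE !trmx_mul symA.
have BA : B *m A = A *m B^T by rewrite {1}AE' !mulmxA -(mulmxA B) -AE.
by split=> //; rewrite BA mulmxA -AE'.
Qed.

(** If [A u = a u] with [a > 0], then [u = A (a^-1 u)]. Conversely, expanding [A v] in an eigenbasis
    leaves only terms with nonzero, hence positive, eigenvalues. *)
Lemma mem_positive_eigenspace (R : realType) (n : nat) (A : 'M[R]_n)
    (w : 'cV[R]_n) :
  A^T = A -> (forall a, eigenvalue A a -> a != 0 -> 0 < a) ->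
  w \in positive_eigenspace A <-> exists v, w = A *m v.
Proof.
move=> symA pos; split=> [/vspan_setP[s sS]|[v ->]].
  suff /subvP sub : (span s <= limg (linfun (mulmx A)))%VS.
    by move=> /sub/memv_imgP[v _ ->]; exists v; rewrite lfunE.
  apply/span_subvP => u /sS[_ [a a0 Au]].
  rewrite -[u](scalerK (lt0r_neq0 a0)) -Au memvZ//.
  by apply/memv_imgP; exists u; rewrite ?memvf// lfunE.
have [P Pu /(similar_diagLR Pu)[d AE]] := symmetric_diagonalizable symA.
rewrite conjVmx// in AE.
have rowdP i : row i (diag_mx d *m P) = d 0 i *: row i P.
  by rewrite row_mul row_diag_mx -scalemxAl -rowE.
have PA i : row i P *m A = d 0 i *: row i P.
  by rewrite -row_mul AE !mulmxA mulmxV// mul1mx rowdP.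
(* The rows of [P] are the eigenbasis, and [v^T *m invmx P] holds the coordinates of [v] in it. *)
have -> : A *m v = \sum_i (v^T *m invmx P) 0 i *: (d 0 i *: (row i P)^T).
  apply: trmx_inj; rewrite trmx_mul symA {1}AE !mulmxA linear_sum/=.
  rewrite -mulmxA mulmx_sum_row; apply: eq_bigr => i _.
  by rewrite !linearZ/= trmxK rowdP.
apply: memv_suml => i _; apply: memvZ.
have [->|di0] := eqVneq (d 0 i) 0; first by rewrite scale0r mem0v.
have rP0 : row i P != 0.
  rewrite rowE mulmx_free_eq0 ?row_free_unit//.
  by apply/eqP => /matrixP/(_ 0 i)/eqP; rewrite !mxE !eqxx oner_eq0.
apply/memvZ/vspan_setP; exists [:: (row i P)^T]; last exact: memv_span1.
move=> u; rewrite inE => /eqP->; split; first by rewrite trmx_eq0.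
exists (d 0 i); last by apply: trmx_inj; rewrite trmx_mul symA trmxK linearZ/= trmxK PA.
by apply: pos => //; apply/eigenvalueP; exists (row i P).
Qed.

Theorem lemma2p7 (R : realType) (n : nat) (D : plots R 'cV[R]_n) (A : 'M[R]_n)
  (dvsD : is_dvs D) (pmA : pseudo_metric D A) :
  splits_off D (positive_eigenspace A).
Proof.
have [symA smoothA _ pos] := pmA.
have imA w := mem_positive_eigenspace w symA pos.
have [B [C [BA ABA]]] := symmetric_projection symA.
exists (lker (linfun (mulmx A))).
apply: (@smooth_projection_decomposition _ _ _ _ _ (fun v => B *m A *m v)) => //.
(* A vector [A v] in the kernel satisfies [A A v = 0], hence vanishes. *)
- apply/directv_addP/eqP; rewrite -subv0; apply/subvP => w.
  rewrite memv_cap memv_ker lfunE/= => /andP[/imA[v ->] /eqP AAv].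
  by rewrite memv0 (symmetric_kernel_sqr symA AAv).
- exact: smooth_mulmx_form.
- by move=> v; apply/imA; exists (C *m v); rewrite BA mulmxA.
- by move=> v; rewrite memv_ker lfunE/= mulmxBr mulmxA ABA subrr.
Qed.
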